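(* Consider an instance of the Permutation Flowshop Scheduling Problem with $N$ jobs, $M$ machines and processing times satisfying $a \le t_{i,j} \le b$ for all $1\le i\le M$, $1\le j\le N$. Then for every permutation $\pi$ of the jobs, $$a(N+M-1) \le OPT \le C_{max}(\pi) \le b(N+M-1).$$
   Context: Permutation Flowshop Scheduling Problem (PFSP): an instance consists of $N\ge 1$ jobs, $M\ge 1$ machines, and a matrix of constant non-negative processing times $t_{i,j}$ ($1\le i\le M$, $1\le j\le N$), where $t_{i,j}$ is the processing time of job $j$ on machine $i$. A schedule is a permutation $\pi=(\pi_1,\dots,\pi_N)$ of the jobs. For a given $\pi$ the completion times $C_{i,j}$ are defined by $C_{1,\pi_1}=t_{1,\pi_1}$; $C_{i,\pi_1}=t_{i,\pi_1}+C_{i-1,\pi_1}$ for $1<i\le M$; $C_{1,\pi_j}=t_{1,\pi_j}+C_{1,\pi_{j-1}}$ for $1<j\le N$; and $C_{i,\pi_j}=t_{i,\pi_j}+\max\{C_{i-1,\pi_j},C_{i,\pi_{j-1}}\}$ otherwise. The makespan is $C_{max}(\pi)=C_{M,\pi_N}$, and $OPT=\min_\pi C_{max}(\pi)$, the minimum over all permutations of the jobs. *)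

(* Defs.v *)
From mathcomp Require Import all_boot all_order all_algebra all_fingroup.

Set Implicit Arguments.
Unset Strict Implicit.
Unset Printing Implicit Defensive.

Import Order.TTheory GRing.Theory Num.Theory.

Local Open Scope ring_scope.

(* An instance with M = m.+1 machines and N = n.+1 jobs is the matrix
   t : 'M[R]_(m.+1, n.+1), where t i j is the processing time of job j on
   machine i. A schedule is s : 'S_n.+1, where s k is the job in position k.
   Machines, jobs and positions are numbered from 0. *)

Definition ptime (R : realFieldType) (m n : nat) (t : 'M[R]_(m.+1, n.+1))
    (s : 'S_n.+1) (i k : nat) : R :=
  t (inord i) (s (inord k)).

(* completion t s i k is the completion time on machine i of the job in
   position k, i.e., C_{i, s k}. The indices are nat so that the recursion is
   structural; the value is meaningful only for i <= m and k <= n. *)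
Fixpoint completion (R : realFieldType) (m n : nat) (t : 'M[R]_(m.+1, n.+1))
    (s : 'S_n.+1) (i : nat) {struct i} : nat -> R :=
  match i with
  | 0 => fix row k :=
      match k with
      | 0 => ptime t s 0 0
      | k'.+1 => ptime t s 0 k + row k'
      end
  | i'.+1 => fix row k :=
      match k with
      | 0 => ptime t s i 0 + completion t s i' 0
      | k'.+1 => ptime t s i k + Num.max (completion t s i' k) (row k')
      end
  end.

Lemma completion00 (R : realFieldType) m n (t : 'M[R]_(m.+1, n.+1)) s :
  completion t s 0 0 = ptime t s 0 0.
Proof. by []. Qed.

Lemma completionS0 (R : realFieldType) m n (t : 'M[R]_(m.+1, n.+1)) s i :
  completion t s i.+1 0 = ptime t s i.+1 0 + completion t s i 0.
Proof. by []. Qed.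

Lemma completion0S (R : realFieldType) m n (t : 'M[R]_(m.+1, n.+1)) s k :
  completion t s 0 k.+1 = ptime t s 0 k.+1 + completion t s 0 k.
Proof. by []. Qed.

Lemma completionSS (R : realFieldType) m n (t : 'M[R]_(m.+1, n.+1)) s i k :
  completion t s i.+1 k.+1 =
  ptime t s i.+1 k.+1
  + Num.max (completion t s i k.+1) (completion t s i.+1 k).
Proof. by []. Qed.

Definition makespan (R : realFieldType) (m n : nat) (t : 'M[R]_(m.+1, n.+1))
    (s : 'S_n.+1) : R :=
  completion t s m n.

(* The default value of the iterated minimum is the makespan of the identity
   permutation, which is itself in the range. *)
Definition OPT (R : realFieldType) (m n : nat) (t : 'M[R]_(m.+1, n.+1)) : R :=
  \big[Num.min/makespan t 1%g]_(s : 'S_n.+1) makespan t s.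

(* Main.v *)
Require Import Defs.
From mathcomp Require Import all_boot all_order all_algebra all_fingroup.

Set Implicit Arguments.
Unset Strict Implicit.
Unset Printing Implicit Defensive.

Import Order.TTheory GRing.Theory Num.Theory.
Local Open Scope ring_scope.

(** A completion time is the largest total processing time along a monotone
lattice path from machine 0, position 0 to the cell considered. All such paths
to the cell (i, k) have the same number of cells, namely i + k + 1, so every
completion time lies between a and b times this number. This is
[completion_bounds], by induction along the recursion: both arguments of the
maximum have the same index sum, hence the same bounds. At the last machine
and position the number of cells is N + M - 1, which bounds every makespan.
The optimum is a minimum of makespans over all schedules: it is at most each of
them, and the lower bound common to all of them passes to it. *)

(** The bounds hold at all natural indices because [inord] sends an out-of-range
index to a genuine machine or position, so every [ptime] is an entry of t. *)
Lemma completion_bounds (R : realFieldType) (m n : nat)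
    (t : 'M[R]_(m.+1, n.+1)) (a b : R)
    (t_bounds : forall i j, a <= t i j <= b) (s : 'S_n.+1) (i k : nat) :
  a * (i + k).+1%:R <= completion t s i k <= b * (i + k).+1%:R.
Proof.
(* One more cell on a path of d cells. *)
have step d p c : a <= p <= b -> a * d%:R <= c <= b * d%:R ->
    a * d.+1%:R <= p + c <= b * d.+1%:R.
  move=> /andP[ap pb] /andP[ac cb].
  by rewrite -nat1r !mulrDr !mulr1 !lerD.
have p_bounds i' k' : a <= ptime t s i' k' <= b by apply: t_bounds.
elim: i k => [|i IHi]; elim=> [|k IHk].
- by rewrite completion00 !mulr1.
- by rewrite completion0S; apply: step.
- by rewrite completionS0 addSn; apply: step.
- rewrite completionSS addSn; apply: step => //.
  have /andP[lo hi] := IHi k.+1.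
  have /andP[_ hi'] := IHk.
  by rewrite le_max lo ge_max hi addnS -addSn hi'.
Qed.

Theorem proposition3 (R : realFieldType) (m n : nat)
    (t : 'M[R]_(m.+1, n.+1)) (a b : R)
    (t_ge0 : forall (i : 'I_m.+1) (j : 'I_n.+1), 0 <= t i j)
    (t_bounds : forall (i : 'I_m.+1) (j : 'I_n.+1), a <= t i j <= b)
    (s : 'S_n.+1) :
  [/\ a * (n.+1 + m.+1 - 1)%:R <= OPT t,
      OPT t <= makespan t s
    & makespan t s <= b * (n.+1 + m.+1 - 1)%:R].
Proof.
have cellsE : (n.+1 + m.+1 - 1 = (m + n).+1)%N.
  by rewrite addSn subn1 addnS addnC.
have bounds s' := completion_bounds t_bounds s' m n.
split; rewrite ?cellsE.
- rewrite /OPT; elim/big_ind: _ => [|x y ax ay|s' _].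
  + by have /andP[] := bounds 1%g.
  + by rewrite le_min ax.
  + by have /andP[] := bounds s'.
- exact: bigmin_le_cond.
- by have /andP[] := bounds s.
Qed.
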